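(* Let $n\ge1$ be an integer. There exists an edge-colored, weighted, undirected graph $G$ with $\Theta(n)$ vertices and two distinguished vertices $s,t$, in which every color class has at most $2$ edges, such that every $1$-CFT $(s,t)$-distance preserver of $G$ contains at least $\mathtt{DP}(n,n)$ edges.
   Context: An edge-colored graph assigns each edge exactly one color, with no restrictions; a color class is the set of edges of one color. For a color $c$, $G-c$ denotes $G$ with all edges of color $c$ deleted. A subgraph $H\subseteq G$ is a $1$-CFT $(s,t)$-distance preserver if for every color $c$, the (weighted) distance from $s$ to $t$ in $H-c$ equals that in $G-c$. $\mathtt{DP}(n,p)$ denotes the worst-case size of (fault-free) distance preservers for at most $p$ pairs in $n$-vertex weighted undirected graphs: the smallest $N$ such that every $n$-vertex undirected weighted graph $G'$ and every set $P$ of at most $p$ vertex pairs admit a subgraph $H'\subseteq G'$ with at most $N$ edges such that $\operatorname{dist}_{H'}(x,y)=\operatorname{dist}_{G'}(x,y)$ for all $(x,y)\in P$. *)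

(* Defs.v *)
From HB Require Import structures.
From mathcomp Require Import all_boot all_order all_algebra.
From mathcomp Require Import all_classical all_reals ereal.

Set Implicit Arguments.
Unset Strict Implicit.
Unset Printing Implicit Defensive.

Import Order.TTheory GRing.Theory Num.Theory.
Local Open Scope classical_set_scope.
Local Open Scope ring_scope.

(* Finite simple graphs on the vertex type V: an edge is the two-element set of
   its endpoints.  Only the values of [weight] on edges are meaningful. *)
Record wgraph (R : realType) (V : finType) := WGraph {
  edges : {set {set V}};
  weight : {set V} -> R;
  edges_card2 : forall e, e \in edges -> #|e| = 2%N;
  weight_gt0 : forall e, e \in edges -> 0 < weight e
}.

(* The walk x, p_1, ..., p_k is represented by its first vertex x and the
   sequence p of the remaining ones. *)
Definition is_walk (V : finType) (F : {set {set V}}) (x y : V) (p : seq V) :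
    bool :=
  path (fun u v => [set u; v]%SET \in F) x p && (last x p == y).

Definition walk_length (R : realType) (V : finType) (w : {set V} -> R)
    (x : V) (p : seq V) : R :=
  \sum_(e <- pairmap (fun u v => [set u; v]%SET) x p) w e.

(* Distance from x to y in the graph with edge set F and weights w.  It is +oo
   when y is not reachable from x; for positive weights the infimum is attained
   as soon as a walk exists. *)
Definition dist (R : realType) (V : finType) (w : {set V} -> R)
    (F : {set {set V}}) (x y : V) : \bar R :=
  ereal_inf [set (walk_length w x p)%:E | p in [set p | is_walk F x y p]].

(* A subgraph H of G is given by its set of edges; it keeps the vertices and the
   weights of G. *)
Definition distance_preserver (R : realType) (V : finType) (G : wgraph R V)
    (P : {set V * V}) (H : {set {set V}}) : Prop :=
  H \subset edges G /\
  forall x y : V, (x, y) \in P ->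
    dist (weight G) H x y = dist (weight G) (edges G) x y.

Definition preservers_bounded_by (R : realType) (n p N : nat) : Prop :=
  forall (V : finType) (G : wgraph R V) (P : {set V * V}),
    #|V| = n -> (#|P| <= p)%N ->
    exists H : {set {set V}}, distance_preserver G P H /\ (#|H| <= N)%N.

Lemma preservers_bounded_by_ex (R : realType) (n p : nat) :
  exists N : nat, `[< preservers_bounded_by R n p N >].
Proof.
exists (2 ^ n)%N; apply/asboolP => V G P cardV _.
exists (edges G); split; first by split.
by rewrite -cardV -cardsT -card_powerset; apply/subset_leq_card/fintype.subsetP => A;
  rewrite powersetE finset.subsetT.
Qed.

Definition DP (R : realType) (n p : nat) : nat :=
  ex_minn (preservers_bounded_by_ex R n p).

Record cgraph (R : realType) (V C : finType) := CGraph {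
  cgraph_wgraph :> wgraph R V;
  color : {set V} -> C
}.

Definition color_class (R : realType) (V C : finType) (G : cgraph R V C)
    (c : C) : {set {set V}} :=
  [set e in edges G | color G e == c]%SET.

(* Only colors occurring on an edge of G may fail.  Letting an unused color fail
   as well would amount to also preserving the fault-free distance. *)
Definition cft1_preserver (R : realType) (V C : finType) (G : cgraph R V C)
    (s t : V) (H : {set {set V}}) : Prop :=
  H \subset edges G /\
  forall c : C, color_class G c != finset.set0 ->
    dist (weight G) (H :\: color_class G c)%SET s t =
    dist (weight G) (edges G :\: color_class G c)%SET s t.

(* Main.v *)
(* Take an n-vertex graph G and a set P of at most n pairs attaining DP(n,n).
   Add two paths ("rails") of unit edges, one starting at s and one at t, and link
   the k-th vertices of the rails to the two endpoints of the k-th pair by edges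
   of weight (D+1)(m+1-k), where m = #|P| and D exceeds every finite distance of
   G.  The k-th edges of the two rails share a color.  When color i fails, only
   the links up to height i give access to s and t, and the links at height i are
   cheaper than lower ones by more than D; so the s-t distance is a constant plus
   the distance of the i-th pair.  Hence a 1-CFT preserver restricted to G is a
   preserver for P.  The lower bound on the s-t distance is obtained from a
   potential that is 1-Lipschitz along the surviving edges, which avoids any
   decomposition of walks. *)
Require Import Defs.
From mathcomp Require Import all_boot all_order all_algebra.
From mathcomp Require Import all_classical all_reals ereal.
From mathcomp Require Import zify lra.

Set Implicit Arguments.
Unset Strict Implicit.
Unset Printing Implicit Defensive.

Import Order.TTheory GRing.Theory Num.Theory.
Local Open Scope ring_scope.

(** * Functions and edge sets given by symmetric data on ordered pairs *)

Section Unordered.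
Variables (V : finType) (T : Type).

Lemma set2_eqP (a b u v : V) :
  [set a; b]%SET = [set u; v]%SET ->
  (a = u /\ b = v) \/ (a = v /\ b = u).
Proof.
move=> E.
have /set2P aE : a \in [set u; v]%SET by rewrite -E set21.
have /set2P bE : b \in [set u; v]%SET by rewrite -E set22.
have /set2P uE : u \in [set a; b]%SET by rewrite E set21.
have /set2P vE : v \in [set a; b]%SET by rewrite E set22.
by case: aE bE uE vE => -> [] -> [] ? [] ?; subst; auto.
Qed.

(** The ordering of the endpoints is picked arbitrarily, so the value is meaningful only for
    symmetric [f]; [d] is a default for sets that are not of the form [[set u; v]]. *)
Definition edge_fun (d : T) (f : V -> V -> T) (e : {set V}) : T :=
  if [pick p : V * V | e == [set p.1; p.2]%SET] is Some p then f p.1 p.2 else d.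

Lemma edge_funE d (f : V -> V -> T) u v :
  (forall x y, f x y = f y x) -> edge_fun d f [set u; v]%SET = f u v.
Proof.
move=> fC; rewrite /edge_fun; case: pickP => [[a b] /= /eqP|/(_ (u, v))/=].
  by move=> /set2_eqP[[-> ->]|[-> ->]].
by rewrite eqxx.
Qed.

Definition edge_set (r : rel V) : {set {set V}} :=
  [set [set p.1; p.2]%SET | p : V * V & r p.1 p.2]%SET.

Lemma in_edge_set (r : rel V) u v :
  symmetric r -> ([set u; v]%SET \in edge_set r) = r u v.
Proof.
move=> rC; apply/imsetP/idP => [[[a b]]|ruv]; last by exists (u, v); rewrite ?inE.
by rewrite inE /= => rab /set2_eqP[[-> ->]|[-> ->]] //; rewrite rC.
Qed.

Lemma edge_setP (r : rel V) e :
  reflect (exists u v, r u v /\ e = [set u; v]%SET) (e \in edge_set r).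
Proof.
apply: (iffP imsetP) => [[[a b]]|[u [v [ruv ->]]]].
  by rewrite inE => rab ->; exists a, b.
by exists (u, v); rewrite ?inE.
Qed.

End Unordered.

(** * Potentials, distances and truncated distances *)

Section Distance.
Local Open Scope ereal_scope.
Variables (R : realType) (V : finType) (w : {set V} -> R).
Implicit Types (F : {set {set V}}) (psi : V -> \bar R).

Lemma walk_length_cons x v p :
  walk_length w x (v :: p) = (w [set x; v]%SET + walk_length w v p)%R.
Proof. by rewrite /walk_length /= big_cons. Qed.

Lemma walk_length_nil x : walk_length w x [::] = 0%R.
Proof. by rewrite /walk_length big_nil. Qed.

(** The inequalities telescope along the walk. Values in [\bar R] allow [psi] to be itself a
    distance to a fixed target, possibly infinite. *)
Lemma potential_le_walk F psi x y p :
  (forall u v, [set u; v]%SET \in F -> psi u <= (w [set u; v]%SET)%:E + psi v) ->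
  is_walk F x y p -> psi x <= (walk_length w x p)%:E + psi y.
Proof.
move=> psiP; elim: p x => [|v p IH] x; rewrite /is_walk /=.
  by move=> /eqP ->; rewrite walk_length_nil add0e.
rewrite -andbA => /andP[xv vy]; rewrite walk_length_cons EFinD -addeA.
apply: (le_trans (psiP _ _ xv)).
by rewrite leeD2l // IH.
Qed.

Lemma dist_le_walk F x y p :
  is_walk F x y p -> dist w F x y <= (walk_length w x p)%:E.
Proof. by move=> xy; apply: ereal_inf_lbound; exists p. Qed.

Lemma potential_le_dist F (psi : V -> R) x y :
  (forall u v, [set u; v]%SET \in F -> (psi u <= w [set u; v]%SET + psi v)%R) ->
  (psi x - psi y)%:E <= dist w F x y.
Proof.
move=> psiP; apply: le_ereal_inf_tmp => _ [p xy <-].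
have := @potential_le_walk F (EFin \o psi) x y p.
rewrite /= -EFinD !lee_fin => /(_ _ xy) H.
have {}H := H (fun u v uv => psiP u v uv).
by rewrite lerBlDr.
Qed.

Lemma dist_step F x v y : [set x; v]%SET \in F ->
  dist w F x y <= (w [set x; v]%SET)%:E + dist w F v y.
Proof.
move=> xv; rewrite -leeBlDl//; apply: le_ereal_inf_tmp => _ [p vy <-].
rewrite leeBlDl// -EFinD -walk_length_cons; apply: dist_le_walk.
by move: vy; rewrite /is_walk /= xv.
Qed.

Lemma dist_self_le0 F x : dist w F x x <= 0.
Proof.
by rewrite -[0]/(0%R%:E) -(walk_length_nil x) dist_le_walk // /is_walk /=.
Qed.

Lemma dist_ge0 F x y :
  (forall e, e \in F -> (0 <= w e)%R) -> 0 <= dist w F x y.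
Proof.
move=> w0; have := @potential_le_dist F (fun=> 0%R) x y; rewrite subrr; apply.
by move=> u v /w0; rewrite addr0.
Qed.

Lemma dist_antimono F F' x y :
  F \subset F' -> dist w F' x y <= dist w F x y.
Proof.
move=> /fintype.subsetP FF'; apply: ereal_inf_le_tmp => _ [p xy <-]; exists p => //.
move: xy; rewrite /is_walk /= => /andP[xp ->]; rewrite andbT.
by apply: sub_path xp => u v /= /FF'.
Qed.

Lemma dist_lt_walk F x y r : dist w F x y < r ->
  exists2 p, is_walk F x y p & (walk_length w x p)%:E < r.
Proof. by move=> /ereal_inf_lt[_ [p xy <-]]; exists p. Qed.

(** Truncation at [D] keeps the distance real-valued when [y] is unreachable, without losing the
    Lipschitz bound along edges. *)
Definition trunc_dist (D : R) F (y x : V) : R := fine (mine D%:E (dist w F x y)).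

Section Trunc.
Variables (D : R) (F : {set {set V}}) (y : V).
Hypotheses (D0 : (0 <= D)%R) (w0 : forall e, e \in F -> (0 <= w e)%R).

Lemma trunc_distE x : (trunc_dist D F y x)%:E = mine D%:E (dist w F x y).
Proof.
rewrite /trunc_dist fineK // ge0_fin_numE.
  by rewrite gt_min ltry.
by rewrite le_min lee_fin D0 dist_ge0.
Qed.

Lemma trunc_dist_le x : (trunc_dist D F y x <= D)%R.
Proof. by rewrite -lee_fin trunc_distE ge_min lexx. Qed.

Lemma trunc_dist_ge0 x : (0 <= trunc_dist D F y x)%R.
Proof. by rewrite -lee_fin trunc_distE le_min lee_fin D0 dist_ge0. Qed.

Lemma trunc_dist_self : trunc_dist D F y y = 0%R.
Proof.
apply/eqP; rewrite eq_le trunc_dist_ge0 andbT -lee_fin trunc_distE.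
by rewrite ge_min dist_self_le0 orbT.
Qed.

Lemma trunc_dist_step u v : [set u; v]%SET \in F ->
  (trunc_dist D F y u <= w [set u; v]%SET + trunc_dist D F y v)%R.
Proof.
move=> uv; have wuv := w0 uv.
rewrite -lee_fin EFinD !trunc_distE; case: (leP D%:E (dist w F v y)) => _.
  by rewrite ge_min -EFinD lee_fin lerDr wuv.
by rewrite ge_min dist_step // orbT.
Qed.

End Trunc.
End Distance.

(** * The graph with rails and links, its weights and its color classes *)

Section Gadget.
Variables (R : realType) (V : finType) (G : wgraph R V).
Variables (m : nat) (z : nat -> bool -> V) (D : R).
Hypothesis D0 : 0 < D.

(* Pairs have indices [k < m], rails have heights [k <= m]: the top height only
   provides the upper ends of the last rail edges, and its links to the values
   [z m b] are harmless. *)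
Definition gvertex : finType := (V + 'I_m.+1 * bool)%type.

Definition adj (u v : gvertex) : bool :=
  match u, v with
  | inl x, inl y => [set x; y]%SET \in edges G
  | inl x, inr (k, b) | inr (k, b), inl x => x == z k b
  | inr (j, b), inr (k, c) => (b == c) && ((k == j.+1 :> nat) || (j == k.+1 :> nat))
  end.

Definition link_weight (k : nat) : R := (D + 1) * (m.+1 - k)%:R.

Definition pair_weight (u v : gvertex) : R :=
  match u, v with
  | inl x, inl y => weight G [set x; y]%SET
  | inl _, inr (k, _) | inr (k, _), inl _ => link_weight k
  | inr _, inr _ => 1
  end.

(* The two rail edges leaving height [j] share the color [inl j]; every other
   edge is alone in its color class. *)
Definition pair_color (u v : gvertex) : 'I_m.+1 + {set gvertex} :=
  match u, v with
  | inr (j, _), inr (k, _) => inl (Order.min j k)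
  | _, _ => inr [set u; v]%SET
  end.

Lemma adjC : symmetric adj.
Proof.
move=> [x|[j b]] [y|[k c]] //=; first by rewrite finset.setUC.
by rewrite eq_sym orbC.
Qed.

Lemma pair_weightC u v : pair_weight u v = pair_weight v u.
Proof. by case: u v => [x|[j b]] [y|[k c]] //=; rewrite finset.setUC. Qed.

Lemma pair_colorC u v : pair_color u v = pair_color v u.
Proof.
by case: u v => [x|[j b]] [y|[k c]] /=; rewrite 1?finset.setUC // minC.
Qed.

Lemma adj_neq u v : adj u v -> u != v.
Proof.
apply: contraTneq => <-; case: u => [x|[j b]] /=; last by lia.
by apply/negP => /edges_card2; rewrite finset.setUid cards1.
Qed.

Lemma link_weight_gt k : (k <= m)%N -> D < link_weight k.
Proof.
move=> km; rewrite /link_weight subSn // -natr1 mulrDr mulr1.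
have : 0 <= (D + 1) * (m - k)%:R by rewrite mulr_ge0 ?ler0n ?addr_ge0 ?ltW.
by move: D0; lra.
Qed.

(** Climbing from [k] to [i] costs [i - k] in unit rail edges and saves [(D + 1) * (i - k)] on the
    link: a net gain of [D * (i - k)], at least [D]. *)
Lemma link_weight_drop k i : (k < i)%N -> (i <= m)%N ->
  link_weight i + i%:R + D <= link_weight k + k%:R.
Proof.
move=> ki im; rewrite /link_weight !natrB ?leqW // ?(leq_trans (ltnW ki)) //.
have : k.+1%:R <= i%:R :> R by rewrite ler_nat.
rewrite -natr1 -subr_ge0 => /(mulr_ge0 (ltW D0)).
by move: (m.+1%:R) (i%:R) (k%:R) => a b c; nra.
Qed.

Lemma pair_weight_gt0 u v : adj u v -> 0 < pair_weight u v.
Proof.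
case: u v => [x|[j b]] [y|[k c]] //=; first exact: weight_gt0.
- by move=> _; apply/(lt_trans D0)/link_weight_gt; case: k => /= k; rewrite ltnS.
- by move=> _; apply/(lt_trans D0)/link_weight_gt; case: j => /= j; rewrite ltnS.
Qed.

Fact gadget_card2 e : e \in edge_set adj -> #|e| = 2%N.
Proof. by move=> /edge_setP[u [v [/adj_neq uv ->]]]; rewrite cards2 uv. Qed.

Fact gadget_weight_gt0 e : e \in edge_set adj -> 0 < edge_fun 0 pair_weight e.
Proof.
move=> /edge_setP[u [v [uv ->]]].
by rewrite edge_funE ?pair_weight_gt0 //; exact: pair_weightC.
Qed.

Definition gadget : cgraph R gvertex ('I_m.+1 + {set gvertex})%type :=
  CGraph (WGraph gadget_card2 gadget_weight_gt0)
    (edge_fun (inr finset.set0) pair_color).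

Lemma gadget_edgeE u v : ([set u; v]%SET \in edges gadget) = adj u v.
Proof. exact: in_edge_set adjC. Qed.

Lemma gadget_weightE u v : weight gadget [set u; v]%SET = pair_weight u v.
Proof. by rewrite /= edge_funE //; exact: pair_weightC. Qed.

Lemma gadget_colorE u v : color gadget [set u; v]%SET = pair_color u v.
Proof. by rewrite /= edge_funE //; exact: pair_colorC. Qed.

Lemma color_class_pair c u v :
  ([set u; v]%SET \in color_class gadget c) = adj u v && (pair_color u v == c).
Proof. by rewrite inE gadget_edgeE gadget_colorE. Qed.

Lemma card_gvertex : #|gvertex| = (#|V| + m.+1 * 2)%N.
Proof. by rewrite card_sum card_prod card_ord card_bool. Qed.

Lemma card_gadget_color c : (#|color_class gadget c| <= 2)%N.
Proof.
case: c => [k|e].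
  (* At [k = m] the [inord] falls back to a default height. This is harmless: no rail edge leaves
     the top height upwards, and only an inclusion is claimed. *)
  pose rail (b : bool) : {set gvertex} := [set inr (k, b); inr (inord k.+1, b)]%SET.
  have sub : color_class gadget (inl k) \subset rail @: [set: bool].
    apply/fintype.subsetP => e' e'k.
    have /edge_setP[u [v [uv e'E]]] : e' \in edge_set adj by move: e'k; rewrite inE => /andP[].
    move: e'k; rewrite e'E color_class_pair uv /=.
    case: u v uv {e' e'E} => [x|[j b]] [y|[l c]] //= /andP[/eqP<- jl] /eqP[jlk].
    apply/imsetP; exists b; rewrite ?inE // /rail -jlk.
    case/orP: jl => /eqP E.
      have -> : Order.min j l = j by apply/min_idPl; rewrite leEord E.
      by congr [set _; inr (_, b)]%SET; apply: val_inj; rewrite /= inordK -E.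
    have -> : Order.min j l = l by apply/min_idPr; rewrite leEord E.
    rewrite finset.setUC.
    by congr [set _; inr (_, b)]%SET; apply: val_inj; rewrite /= inordK -E.
  apply: (leq_trans (subset_leq_card sub)).
  by apply: (leq_trans (leq_imset_card _ _)); rewrite cardsT card_bool.
apply: (@leq_trans #|[set e]%SET|); last by rewrite cards1.
apply/subset_leq_card/fintype.subsetP => e' e'k.
have /edge_setP[u [v [uv e'E]]] : e' \in edge_set adj by move: e'k; rewrite inE => /andP[].
move: e'k; rewrite e'E color_class_pair uv /=.
by case: u v {uv e'E} => [x|[j b]] [y|[l c]] //= /eqP[<-]; rewrite inE.
Qed.

(** * Restriction of a subgraph to the core, the copy of [G] *)

Implicit Type H : {set {set gvertex}}.

Definition rail (b : bool) (k : nat) : gvertex := inr (inord k, b).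

Definition core_edges (H : {set {set gvertex}}) : {set {set V}} :=
  [set e : {set V} | [set inl x | x in e]%SET \in H]%SET.

Lemma in_core_edges H u v :
  ([set u; v]%SET \in core_edges H) = ([set inl u; inl v]%SET \in H).
Proof. by rewrite inE imsetU1 imset_set1. Qed.

Lemma core_edges_sub H : H \subset edges gadget -> core_edges H \subset edges G.
Proof.
move=> /fintype.subsetP HG; apply/fintype.subsetP => e; rewrite inE => /HG.
move=> /edge_setP[[x|[j b]] [[y|[k c]] [uv eE]]].
- suff -> : e = [set x; y]%SET by [].
  apply: (imset_inj (f := inl : V -> gvertex)); first by move=> ? ? [].
  by rewrite eE imsetU1 imset_set1.
- have : inr (k, c) \in [set inl x | x in e]%SET by rewrite eE set22.
  by case/imsetP.
- have : inr (j, b) \in [set inl x | x in e]%SET by rewrite eE set21.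
  by case/imsetP.
- have : inr (j, b) \in [set inl x | x in e]%SET by rewrite eE set21.
  by case/imsetP.
Qed.

Lemma card_core_edges H : (#|core_edges H| <= #|H|)%N.
Proof.
have inj : injective (fun e : {set V} => [set inl x | x in e]%SET : {set gvertex}).
  by apply: imset_inj => ? ? [].
rewrite -(card_imset _ inj).
by apply/subset_leq_card/fintype.subsetP => _ /imsetP[e + ->]; rewrite inE.
Qed.

(** * Distances after the failure of the [i]-th rail color *)

Section Fault.
Variable i : nat.
Hypothesis im : (i < m)%N.
Let ci : 'I_m.+1 + {set gvertex} := inl (inord i).

Lemma rail_color b k : (k < m)%N ->
  pair_color (rail b k) (rail b k.+1) = inl (inord k).
Proof.
move=> km; rewrite /=; congr inl; apply/min_idPl.
by rewrite leEord !inordK ?ltnS ?leqnSn // ltnW.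
Qed.

Lemma rail_adj b k : (k < m)%N -> adj (rail b k) (rail b k.+1).
Proof. by move=> km; rewrite /= eqxx !inordK ?eqxx // ltnS ltnW. Qed.

(** A preserver is constrained only by colors that occur on an edge; [i < m] provides a rail edge
    from height [i] to [i.+1]. *)
Lemma color_class_neq0 : color_class gadget ci != finset.set0.
Proof.
apply/finset.set0Pn; exists [set rail true i; rail true i.+1]%SET.
by rewrite color_class_pair rail_adj // rail_color // eqxx.
Qed.

Lemma fault_edgeE u v :
  ([set u; v]%SET \in (edges gadget :\: color_class gadget ci)%SET)
    = adj u v && (pair_color u v != ci).
Proof.
by rewrite inE color_class_pair gadget_edgeE negb_and; case: adj; rewrite ?andbF ?andbT.
Qed.

Section Upper.
Let F := (edges gadget :\: color_class gadget ci)%SET.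

Lemma rail_edge b k : (k < i)%N -> [set rail b k; rail b k.+1]%SET \in F.
Proof.
move=> ki; have km := ltn_trans ki im.
rewrite fault_edgeE rail_adj // rail_color // /ci (inj_eq inl_inj) -val_eqE.
by rewrite [val (inord k)]inordK ?[val (inord i)]inordK ?ltnS 1?ltnW // ltn_eqF.
Qed.

Lemma rail_up b k y : (k <= i)%N ->
  (dist (weight gadget) F (rail b 0) y
    <= k%:R%:E + dist (weight gadget) F (rail b k) y)%E.
Proof.
elim: k => [|k IH] ki; first by rewrite add0e.
apply: (le_trans (IH (ltnW ki))); rewrite -natr1 EFinD -addeA leeD2l //.
by apply: (le_trans (dist_step _ _ (rail_edge b ki))); rewrite gadget_weightE.
Qed.

Lemma rail_down b k : (k <= i)%N ->
  (dist (weight gadget) F (rail b k) (rail b 0) <= k%:R%:E)%E.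
Proof.
elim: k => [|k IH] ki; first exact: dist_self_le0.
have := rail_edge b ki; rewrite finset.setUC => e.
apply: (le_trans (dist_step _ _ e)); rewrite gadget_weightE /=.
by rewrite -nat1r EFinD leeD2l // IH // ltnW.
Qed.

Lemma link_edge b : [set rail b i; inl (z i b)]%SET \in F.
Proof. by rewrite fault_edgeE /= inordK ?eqxx // ltnS ltnW. Qed.

(** The route climbs the first rail to height [i], takes the link, follows [p] in the core, takes
    the other link and descends the second rail; all its edges survive the fault. *)
Lemma fault_dist_le p : is_walk (edges G) (z i true) (z i false) p ->
  (dist (weight gadget) F (rail true 0) (rail false 0)
   <= (2 * (link_weight i + i%:R) + walk_length (weight G) (z i true) p)%:E)%E.
Proof.
move=> zp; set t := rail false 0.
have coreP u v : [set u; v]%SET \in edges G ->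
    (dist (weight gadget) F (inl u) t
       <= (weight G [set u; v]%SET)%:E + dist (weight gadget) F (inl v) t)%E.
  move=> uv; have e : [set inl u; inl v]%SET \in F by rewrite fault_edgeE /= uv.
  by apply: (le_trans (dist_step _ _ e)); rewrite gadget_weightE.
have mid := potential_le_walk (psi := fun u => dist (weight gadget) F (inl u) t) coreP zp.
have up := rail_up true t (leqnn i).
have := dist_step (weight gadget) t (link_edge true).
have := link_edge false; rewrite finset.setUC => e.
have := dist_step (weight gadget) t e.
rewrite !gadget_weightE /= inordK ?ltnS 1?ltnW // => dn ln.
apply: (le_trans up); rewrite -leeBrDl //.
apply: (le_trans ln); rewrite -leeBrDl //.
apply: (le_trans mid); rewrite -leeBrDl //.
apply: (le_trans dn); rewrite -leeBrDl //.
apply: (le_trans (rail_down false (leqnn i))).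
by rewrite -!EFinB lee_fin; lra.
Qed.

End Upper.

Section Lower.
Variable H : {set {set gvertex}}.
Hypothesis HG : H \subset edges gadget.

Let f := trunc_dist (weight G) D (core_edges H) (z i false).

Let w0 e : e \in core_edges H -> 0 <= weight G e.
Proof. by move=> eH; apply/ltW/weight_gt0/(fintype.subsetP (core_edges_sub HG)). Qed.

Let base := link_weight i + i%:R.

(* A lower bound on the distance to the end of the second rail after the fault;
   vertices beyond the faulty rail edges can only be left through the core, so
   [base] suffices for them. *)
Definition potential (u : gvertex) : R :=
  match u with
  | inl x => base + f x
  | inr (k, true) =>
      if (k <= i)%N then base + (base - k%:R) + f (z i true) else base
  | inr (k, false) => if (k <= i)%N then k%:R else base
  end.

(** Core edges inherit the Lipschitz bound of [f]. Links at height [i] attain equality when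
    traversed from the first rail towards the second. Lower links have slack [D] by
    [link_weight_drop] and higher ones weigh more than [D], which absorbs the values of [f], all at
    most [D]. Rail edges change the potential by at most 1. *)
Lemma potential_step u v :
  [set u; v]%SET \in (H :\: color_class gadget ci)%SET ->
  potential u <= weight gadget [set u; v]%SET + potential v.
Proof.
move=> uvHc; have uvH : [set u; v]%SET \in H by move: uvHc; rewrite inE => /andP[].
have : [set u; v]%SET \in (edges gadget :\: color_class gadget ci)%SET.
  by move: uvHc; rewrite !inE => /andP[-> /(fintype.subsetP HG)].
rewrite fault_edgeE gadget_weightE => /andP[uv uvc].
have fge x : 0 <= f x by apply: trunc_dist_ge0 w0 _; exact: ltW.
have fle x : f x <= D by apply: trunc_dist_le w0 _; exact: ltW.
have f0 : f (z i false) = 0 by apply: trunc_dist_self w0; exact: ltW.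
have Wi := link_weight_gt (ltnW im).
have i0 : 0 <= i%:R :> R by [].
have W k : (k < i)%N -> base + D <= link_weight k + k%:R.
  by move=> ki; rewrite /base (link_weight_drop ki (ltnW im)).
have Wm (k : 'I_m.+1) : D < link_weight k by apply: (link_weight_gt); rewrite -ltnS.
have le_i (k : nat) : (k <= i)%N -> k%:R <= i%:R :> R by rewrite ler_nat.
have link (k : 'I_m.+1) b :
    potential (inl (z k b)) <= link_weight k + potential (inr (k, b)) /\
    potential (inr (k, b)) <= link_weight k + potential (inl (z k b)).
  have := Wm k; have := fge (z k b); have := fle (z k b); have := D0.
  have := fle (z i true); have := fge (z i true).
  case: b => /=; case: (ltngtP k i) => ki.
  - by have := W _ ki; have := le_i _ (ltnW ki); move: Wi i0; rewrite /base; lra.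
  - by move: Wi i0; rewrite /base; lra.
  - by rewrite ki; move: Wi i0; rewrite /base; lra.
  - by have := W _ ki; have := le_i _ (ltnW ki); move: Wi i0; rewrite /base; lra.
  - by move: Wi i0; rewrite /base; lra.
  - by rewrite ki f0; move: Wi i0; rewrite /base; lra.
case: u v uv uvc uvH {uvHc} => [x|[j b]] [y|[k c]].
- move=> _ _; rewrite -in_core_edges => xy.
  by rewrite addrCA lerD2l; apply: trunc_dist_step xy; [exact: ltW | exact: w0].
- by move=> /eqP-> _ _; case: (link k c).
- by move=> /eqP-> _ _; case: (link j b).
- move=> /andP[/eqP<- jk] jkc _.
  (* Rail edges joining a height at most [i] to one above [i] all have the failed color. *)
  have same : ((j <= i) = (k <= i))%N.
    have {jkc} : val (Order.min j k) != i.
      apply: contraNneq jkc => jki; rewrite /ci (inj_eq inl_inj) -val_eqE.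
      by rewrite [val (inord i)]inordK ?jki // ltnS ltnW.
    rewrite minEle leEord; case/orP: jk => /eqP->.
      by rewrite leqnSn /=; lia.
    by rewrite ltnn /=; lia.
  by case/orP: jk => /eqP E; move: same; case: b {jkc} => /=;
    rewrite E => ->; case: ifP => _; rewrite -?natr1; lra.
Qed.

Lemma fault_dist_ge :
  ((2 * base + f (z i true))%:E <=
   dist (weight gadget) (H :\: color_class gadget ci)%SET (rail true 0) (rail false 0))%E.
Proof.
have := potential_le_dist (rail true 0) (rail false 0) potential_step.
rewrite /= inordK //= subr0; congr (_ <= _)%E; congr _%:E; lra.
Qed.

End Lower.

(** A distance in [G] strictly below the one in the core is finite, hence below [D], so truncation
    does not hide the gap. Some walk of [G] is then shorter than the truncated core distance, and
    the upper bound for [G] contradicts the lower bound for [H]. *)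
Lemma core_preserves H :
  cft1_preserver gadget (rail true 0) (rail false 0) H ->
  (dist (weight G) (edges G) (z i true) (z i false) < +oo ->
   dist (weight G) (edges G) (z i true) (z i false) < D%:E)%E ->
  dist (weight G) (core_edges H) (z i true) (z i false)
  = dist (weight G) (edges G) (z i true) (z i false).
Proof.
move=> [HG Hpres] dD; have sub := core_edges_sub HG.
apply/eqP; rewrite eq_le (dist_antimono _ _ _ sub) andbT leNgt; apply/negP => lt.
have dltD : (dist (weight G) (edges G) (z i true) (z i false) < D%:E)%E.
  by apply: dD; apply: (lt_le_trans lt); rewrite leey.
have w0 e : e \in core_edges H -> 0 <= weight G e.
  by move=> eH; apply/ltW/weight_gt0/(fintype.subsetP sub).
have : (dist (weight G) (edges G) (z i true) (z i false)
   < (trunc_dist (weight G) D (core_edges H) (z i false) (z i true))%:E)%E.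
  by rewrite trunc_distE ?lt_min ?dltD ?lt // ltW.
move=> /dist_lt_walk[p zp]; rewrite lte_fin => plt.
have := fault_dist_ge HG; rewrite (Hpres _ color_class_neq0).
move=> /le_trans/(_ (fault_dist_le zp)); rewrite lee_fin; lra.
Qed.

End Fault.

End Gadget.

(** * An extremal instance, and the theorem *)

Lemma DP_attained (R : realType) (n p : nat) :
  exists (V : finType) (G : wgraph R V) (P : {set V * V}),
    [/\ #|V| = n, (#|P| <= p)%N &
        forall H : {set {set V}}, distance_preserver G P H -> (DP R n p <= #|H|)%N].
Proof.
(* By minimality the predecessor of [DP] fails as a bound, and an instance witnessing the failure is
   the one sought. If [DP] is 0 any instance serves, here an edgeless graph. *)
rewrite /DP; case: ex_minnP => N _ Nmin; case: N Nmin => [|N] Nmin.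
  have no_edge (Q : {set 'I_n} -> Prop) e : e \in finset.set0 -> Q e by rewrite inE.
  exists 'I_n, (@WGraph R _ finset.set0 (fun=> 1) (no_edge _) (no_edge _)), finset.set0.
  by split; rewrite ?card_ord ?cards0.
apply: contrapT => noG; suff /asboolP/Nmin : preservers_bounded_by R n p N by rewrite ltnn.
move=> V G P Vn Pp; apply: contrapT => noH; apply: noG; exists V, G, P; split=> // H GPH.
by rewrite ltnNge; apply/negP => HN; apply: noH; exists H.
Qed.

Lemma finite_dist_bound (R : realType) (V : finType) (G : wgraph R V) :
  exists2 D : R, 0 < D & forall x y,
    (dist (weight G) (edges G) x y < +oo -> dist (weight G) (edges G) x y < D%:E)%E.
Proof.
pose d (q : V * V) := dist (weight G) (edges G) q.1 q.2.
have d0 q : (0 <= d q)%E by apply: dist_ge0 => e /weight_gt0/ltW.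
(* Since [fine] sends [+oo] to 0, the sum dominates every finite distance; the added 1 makes the
   bound strict. *)
exists (1 + \sum_q fine (d q)) => [|x y dxy].
  by rewrite ltr_pwDl // sumr_ge0 // => q _; exact: fine_ge0.
have dfin : d (x, y) \is a fin_num by rewrite ge0_fin_numE.
rewrite -[dist _ _ x y]/(d (x, y)) -(fineK dfin) lte_fin (bigD1 (x, y)) //=.
rewrite addrCA ltrDl ltr_pwDl // sumr_ge0 // => q _; exact: fine_ge0.
Qed.

Theorem theorem4p3 (R : realType) :
  exists c1 c2 : R, 0 < c1 /\ 0 < c2 /\
    forall n : nat, (1 <= n)%N ->
      exists (V C : finType) (G : cgraph R V C) (s t : V),
        [/\ c1 * n%:R <= #|V|%:R <= c2 * n%:R,
            s != t,
            forall c : C, (#|color_class G c| <= 2)%N &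
            forall H : {set {set V}},
              cft1_preserver G s t H -> (DP R n n <= #|H|)%N].
Proof.
(* The gadget has [n + 2 * (#|P| + 1)] vertices, at most [5 * n] since [#|P| <= n] and [1 <= n]. *)
exists 1, 5; split; [lra | split; [lra |]] => n n1.
have [V [G [P [Vn Pn DPle]]]] := DP_attained R n n.
have [D D0 dD] := finite_dist_bound G.
have /card_gt0P[v0 _] : (0 < #|V|)%N by rewrite Vn.
(* The default pair is reached only at index [#|P|], by the links at the top height. *)
pose z k (b : bool) : V :=
  let q := nth (v0, v0) (enum P) k in if b then q.1 else q.2.
exists (gvertex V #|P|), ('I_#|P|.+1 + {set gvertex V #|P|})%type.
exists (gadget G #|P| z D0), (rail V #|P| true 0), (rail V #|P| false 0); split.
- by rewrite card_gvertex Vn mul1r -natrM !ler_nat; lia.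
- by apply: contraTneq isT => /(congr1 (fun u => if u is inr (_, b) then b else true)).
- exact: card_gadget_color.
move=> H Hpres; apply: leq_trans (card_core_edges H); apply: DPle; split.
  by apply: core_edges_sub (proj1 Hpres).
(* The color that fails is given by the position of the pair in the enumeration of [P]. *)
move=> x y xyP; pose k := index (x, y) (enum P).
have kP : (k < #|P|)%N by rewrite cardE index_mem mem_enum.
have zE : nth (v0, v0) (enum P) k = (x, y) by rewrite nth_index // mem_enum.
by have := core_preserves kP Hpres (dD _ _); rewrite /z zE.
Qed.
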